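(* Let $N\ge1$ be an integer and let $\gamma_n,\beta_n,\epsilon_n>0$ ($n=1,\dots,N$) be real constants with $\sum_{n=1}^N\gamma_n=1$. Consider the problem $$\max_{\alpha_1,\dots,\alpha_N\ge 0}\ \sum_{n=1}^N\gamma_n\log_2\left(1+\frac{\beta_n\alpha_n}{\alpha_n+\epsilon_n}\right)\quad\text{subject to}\quad \sum_{n=1}^N\alpha_n=1.$$ The optimal solution $(\alpha_1^\star,\dots,\alpha_N^\star)$ satisfies, for all $n\in\{1,\dots,N\}$, $$\alpha_n^\star=\left(\frac{-(2+\beta_n)\epsilon_n+\sqrt{\beta_n^2\epsilon_n^2+4\nu^\star\gamma_n\beta_n(1+\beta_n)\epsilon_n}}{2(1+\beta_n)}\right)^+,$$ where $\nu^\star\ge 0$ is a real number selected so that $\sum_{n=1}^N\alpha_n^\star=1$.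
   Context: $(x)^+=\max(0,x)$. In the application, $\gamma_n=B_n/\sum_{m=1}^N B_m$ is the proportion of bandwidth of band $n$ (bandwidths $B_n>0$), and $\beta_n,\epsilon_n$ are positive constants determined by channel and noise parameters. *)

(* Defs.v *)
From HB Require Import structures.
From mathcomp Require Import all_boot all_order all_algebra.
From mathcomp Require Import reals exp.

Set Implicit Arguments.
Unset Strict Implicit.
Unset Printing Implicit Defensive.

Import Order.TTheory GRing.Theory Num.Theory.
Local Open Scope ring_scope.

Definition log2 (R : realType) (x : R) : R := ln x / ln 2.

Definition pospart (R : realType) (x : R) : R := Num.max 0 x.

Definition objective (R : realType) (N : nat) (gamma beta eps : 'I_N -> R)
    (alpha : 'I_N -> R) : R :=
  \sum_(n < N) gamma n *
    log2 (1 + beta n * alpha n / (alpha n + eps n)).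

Definition feasible (R : realType) (N : nat) (alpha : 'I_N -> R) : Prop :=
  (forall n, 0 <= alpha n) /\ \sum_(n < N) alpha n = 1.

Definition optimal (R : realType) (N : nat) (gamma beta eps : 'I_N -> R)
    (alpha : 'I_N -> R) : Prop :=
  feasible alpha /\
  forall alpha' : 'I_N -> R, feasible alpha' ->
    objective gamma beta eps alpha' <= objective gamma beta eps alpha.

Definition allocation (R : realType) (N : nat) (gamma beta eps : 'I_N -> R)
    (nu : R) (n : 'I_N) : R :=
  pospart
    ((- (2 + beta n) * eps n
      + Num.sqrt (beta n ^+ 2 * eps n ^+ 2
                  + 4 * nu * gamma n * beta n * (1 + beta n) * eps n))
     / (2 * (1 + beta n))).

(* Main.v *)
(** The allocation at a price [nu > 0] satisfies the KKT conditions with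
    multiplier [1 / nu]. Each summand of the objective is strictly concave,
    hence lies strictly below its tangent away from the point of tangency;
    summing these bounds over feasible points makes the allocation the unique
    maximizer. A price with total allocation 1 exists by the intermediate value
    theorem. *)
Require Import Defs.
From HB Require Import structures.
From mathcomp Require Import all_boot all_order all_algebra.
From mathcomp Require Import reals exp.
From mathcomp Require Import ring lra.
From mathcomp Require Import classical_sets topology normedtype realfun.

Set Implicit Arguments.
Unset Strict Implicit.
Unset Printing Implicit Defensive.

Import Order.TTheory GRing.Theory Num.Theory.
Import numFieldNormedType.Exports.
Local Open Scope ring_scope.

Section Rate.
Variables (R : realType) (b e : R).
Hypotheses (hb : 0 < b) (he : 0 < e).

Let lin_gt0 (x : R) : 0 <= x -> 0 < (1 + b) * x + e.
Proof. by move=> hx; rewrite ltr_wpDl// mulr_ge0// ltW// addr_gt0. Qed.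

(** The two logarithms combine into [ln (1 + d)], which is at most [d]. The tangent value exceeds
    [d] by a positive multiple of [(x - a) ^+ 2], and this is where strictness comes from. *)
Lemma ln_rate_lt_tangent (a x : R) : 0 <= a -> 0 <= x -> x != a ->
  ln (1 + b * x / (x + e)) - ln (1 + b * a / (a + e)) <
  b * e * (x - a) / ((a + e) * ((1 + b) * a + e)).
Proof.
move=> ha hx hxa.
have hae : 0 < a + e by rewrite ltr_wpDl.
have hxe : 0 < x + e by rewrite ltr_wpDl.
have hA := lin_gt0 ha; have hX := lin_gt0 hx.
have -> : 1 + b * x / (x + e) = ((1 + b) * x + e) / (x + e).
  by field; rewrite gt_eqF.
have -> : 1 + b * a / (a + e) = ((1 + b) * a + e) / (a + e).
  by field; rewrite gt_eqF.
rewrite -ln_div ?posrE ?divr_gt0//.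
set d := b * e * (x - a) / ((x + e) * ((1 + b) * a + e)).
have -> : ((1 + b) * x + e) / (x + e) / (((1 + b) * a + e) / (a + e)) = 1 + d.
  by rewrite /d; field; rewrite !gt_eqF.
have hd : -1 < d.
  have : 0 < 1 + d.
    have -> : 1 + d =
        ((1 + b) * x + e) * (a + e) / ((x + e) * ((1 + b) * a + e)).
      by rewrite /d; field; rewrite !gt_eqF.
    by rewrite divr_gt0// mulr_gt0.
  lra.
apply: le_lt_trans (le_ln1Dx hd) _.
rewrite -subr_gt0.
have -> : b * e * (x - a) / ((a + e) * ((1 + b) * a + e)) - d =
    b * e * (x - a) ^+ 2 / ((a + e) * ((1 + b) * a + e) * (x + e)).
  by rewrite /d; field; rewrite !gt_eqF.
have : 0 < (x - a) ^+ 2 by rewrite exprn_even_gt0//= subr_eq0.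
by move: (_ ^+ 2) => q q0; rewrite divr_gt0 ?mulr_gt0.
Qed.

End Rate.

Section Allocation.
Variables (R : realType) (N : nat) (gamma beta eps : 'I_N -> R).
Hypotheses (hgamma : forall n, 0 < gamma n) (hbeta : forall n, 0 < beta n)
  (heps : forall n, 0 < eps n).

Local Notation alloc := (allocation gamma beta eps).

Lemma allocation_ge0 nu n : 0 <= alloc nu n.
Proof. by rewrite /allocation /pospart le_max lexx. Qed.

Lemma allocation_nu0 n : alloc 0 n = 0.
Proof.
rewrite /allocation /pospart; apply/max_idPl.
rewrite mulr0 !mul0r addr0 -exprMn sqrtr_sqr ger0_norm; last first.
  by rewrite mulr_ge0 ?ltW.
rewrite pmulr_lle0 ?invr_gt0 ?mulr_gt0 ?addr_gt0//.
have := heps n; lra.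
Qed.

(* Solves the stationarity equation at [alpha n = 1]. *)
Definition hitting_price n : R :=
  (1 + eps n) * (1 + beta n + eps n) / (gamma n * beta n * eps n).

Lemma hitting_price_ge0 n : 0 <= hitting_price n.
Proof. by rewrite ltW// divr_gt0 ?mulr_gt0 ?addr_gt0. Qed.

Lemma allocation_hitting_price n : alloc (hitting_price n) n = 1.
Proof.
have [[hg hb] he] := (hgamma n, hbeta n, heps n).
have h1b : 0 < 1 + beta n by rewrite addr_gt0.
rewrite /allocation /pospart.
have -> : beta n ^+ 2 * eps n ^+ 2
    + 4 * hitting_price n * gamma n * beta n * (1 + beta n) * eps n =
    (2 * (1 + beta n) + (2 + beta n) * eps n) ^+ 2.
  by rewrite /hitting_price; field; rewrite !gt_eqF.
rewrite sqrtr_sqr ger0_norm; last first.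
  by rewrite addr_ge0 ?mulr_ge0 ?addr_ge0 ?ltW.
have -> : - (2 + beta n) * eps n + (2 * (1 + beta n) + (2 + beta n) * eps n) =
    2 * (1 + beta n) by ring.
by rewrite divff ?gt_eqF ?mulr_gt0//; apply/max_idPr; exact: ler01.
Qed.

(* Stationarity and complementary slackness, with denominators cleared. *)
Lemma allocation_kkt nu n x : 0 <= nu -> 0 <= x ->
  nu * gamma n * beta n * eps n * (x - alloc nu n) <=
  (alloc nu n + eps n) * ((1 + beta n) * alloc nu n + eps n) * (x - alloc nu n).
Proof.
move=> hnu hx; have [[hg hb] he] := (hgamma n, hbeta n, heps n).
have h1b : 0 < 1 + beta n by rewrite addr_gt0.
rewrite /allocation /pospart.
set D := beta n ^+ 2 * eps n ^+ 2 + _.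
have hD : 0 <= D by rewrite addr_ge0 ?mulr_ge0// ltW.
have hs := sqr_sqrtr hD; set s := Num.sqrt D in hs *.
have hs0 : 0 <= s := sqrtr_ge0 D.
set a := _ / _.
(* Undoing the quadratic formula: with [s] affine in the unclipped root [a], both cases below become
   polynomial. *)
have has : s = 2 * (1 + beta n) * a + (2 + beta n) * eps n.
  by rewrite /a; field; rewrite gt_eqF.
have key : 4 * (1 + beta n) * (nu * gamma n * beta n * eps n) =
    s ^+ 2 - beta n ^+ 2 * eps n ^+ 2 by rewrite hs /D; ring.
case: (leP a 0) => ha.
(* Clipped case: what remains is [nu * gamma n * beta n * eps n <= eps n * eps n]. It follows by
   squaring [s <= (2 + beta n) * eps n], as [(2 + b)^2 - b^2 = 4 (1 + b)]. *)
- rewrite !(add0r, mulr0, subr0) ler_wpM2r//.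
  rewrite -(ler_pM2l (_ : 0 < 4 * (1 + beta n))) ?mulr_gt0// key.
  have hsle : s <= (2 + beta n) * eps n.
    by rewrite has gerDr pmulr_rle0 ?mulr_gt0.
  have hs2 : s ^+ 2 <= ((2 + beta n) * eps n) ^+ 2.
    by rewrite lerXn2r ?nnegrE// (le_trans hs0).
  have -> : 4 * (1 + beta n) * (eps n * eps n) =
      ((2 + beta n) * eps n) ^+ 2 - beta n ^+ 2 * eps n ^+ 2 by ring.
  by rewrite lerD2r.
(* Interior case: [a] is the positive root of the stationarity quadratic, so equality holds. *)
- suff -> : nu * gamma n * beta n * eps n =
    (a + eps n) * ((1 + beta n) * a + eps n) by [].
  apply: (mulfI (_ : 4 * (1 + beta n) != 0)); first by rewrite gt_eqF ?mulr_gt0.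
  by rewrite key has; ring.
Qed.

(** The KKT inequality replaces the tangent slope of band [n] by [1 / (nu * ln 2)], which is the
    same for all bands, so that the linear terms can be summed. *)
Lemma allocation_tangent nu n x : 0 < nu -> 0 <= x -> x != alloc nu n ->
  gamma n * log2 (1 + beta n * x / (x + eps n))
  - gamma n * log2 (1 + beta n * alloc nu n / (alloc nu n + eps n)) <
  (x - alloc nu n) / (nu * ln 2).
Proof.
move=> hnu hx hxa; have [[hg hb] he] := (hgamma n, hbeta n, heps n).
have ha := allocation_ge0 nu n; have hk := allocation_kkt n (ltW hnu) hx.
have ht := ln_rate_lt_tangent hb he ha hx hxa.
set a := alloc nu n in ha hk ht *.
have hl2 : 0 < ln 2 :> R by rewrite ln_gt0// ltr1n.
have hQ : 0 < (a + eps n) * ((1 + beta n) * a + eps n).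
  by rewrite mulr_gt0// ltr_wpDl// mulr_ge0// addr_ge0// ltW.
rewrite /log2 -mulrBr -mulrBl mulrA invfM mulrA ltr_pM2r ?invr_gt0//.
apply: lt_le_trans (_ : gamma n *
  (beta n * eps n * (x - a) / ((a + eps n) * ((1 + beta n) * a + eps n))) <= _).
  by rewrite ltr_pM2l.
rewrite mulrA ler_pdivrMr// [leRHS]mulrAC ler_pdivlMr//.
rewrite [leRHS]mulrC; apply: le_trans hk; rewrite le_eqVlt.
by apply/orP; left; apply/eqP; ring.
Qed.

(** At price zero every band gets nothing, so the total could not be 1. This makes the multiplier
    [1 / nu] meaningful. *)
Lemma sum_allocation1_gt0 nu : 0 <= nu -> \sum_(n < N) alloc nu n = 1 -> 0 < nu.
Proof.
rewrite le_eqVlt => /predU1P[<-|//].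
rewrite big1 => [/esym/eqP|n _]; first by rewrite oner_eq0.
exact: allocation_nu0.
Qed.

Section FixedPrice.
Variable nu : R.
Hypotheses (hnu : 0 <= nu) (hsum : \sum_(n < N) alloc nu n = 1).

Let nu_gt0 : 0 < nu := sum_allocation1_gt0 hnu hsum.

(** The gap in the tangent bound. At a feasible point the linear parts cancel in the sum, both
    totals being 1, which leaves exactly the optimality gap. *)
Let slack (x : 'I_N -> R) n := (x n - alloc nu n) / (nu * ln 2)
  - (gamma n * log2 (1 + beta n * x n / (x n + eps n))
     - gamma n * log2 (1 + beta n * alloc nu n / (alloc nu n + eps n))).

Let slack_ge0 x n : feasible x -> 0 <= slack x n.
Proof.
move=> [hx _]; rewrite /slack; have [->|hne] := eqVneq (x n) (alloc nu n).
  by rewrite !subrr mul0r subr0.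
by rewrite subr_ge0 ltW// allocation_tangent.
Qed.

Let sum_slack x : feasible x ->
  \sum_(n < N) slack x n =
  objective gamma beta eps (alloc nu) - objective gamma beta eps x.
Proof.
move=> [_ hx1]; rewrite sumrB -mulr_suml !sumrB hx1 hsum subrr mul0r sub0r.
by rewrite opprB.
Qed.

Lemma allocation_optimal : optimal gamma beta eps (alloc nu).
Proof.
split=> [|x hx]; first by split=> // n; exact: allocation_ge0.
by rewrite -subr_ge0 -sum_slack// sumr_ge0// => n _; exact: slack_ge0.
Qed.

(** A second maximizer has total slack zero; the slacks are nonnegative, so each one vanishes, which
    strictness allows only at the point of tangency. *)
Lemma optimal_eq_allocation x : optimal gamma beta eps x -> x =1 alloc nu.
Proof.
move=> [hx hopt] n.
have h0 : \sum_(m < N) slack x m = 0.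
  apply/eqP; rewrite eq_le sum_slack// subr_le0 subr_ge0.
  have [hfeas hmax] := allocation_optimal.
  by apply/andP; split; [exact: hopt | exact: hmax].
have /(_ n isT) := psumr_eq0P (fun m _ => slack_ge0 m hx) h0.
case: (eqVneq (x n) (alloc nu n)) => // hne /eqP.
by rewrite /slack subr_eq0 gt_eqF// allocation_tangent//; case: hx.
Qed.

End FixedPrice.

Lemma continuous_sum_allocation :
  continuous (fun nu : R => \sum_(n < N) alloc nu n).
Proof.
move=> nu; apply: cvg_big => [|n _]; first exact: add_continuous.
rewrite /allocation /pospart.
apply: (@continuous_max _ _ (fun=> 0) _ nu); first exact: cst_continuous.
apply: cvgM; last exact: cvg_cst.
apply: cvgD; first exact: cvg_cst.
apply: continuous_cvg; first exact: sqrt_continuous.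
apply: cvgD; first exact: cvg_cst.
do 4 (apply: cvgM; last exact: cvg_cst).
by apply: cvgM; [exact: cvg_cst | exact: cvg_id].
Qed.

(** The total is 0 at price 0. At the hitting price of any one band, that band alone already
    receives 1, so the total is at least 1. *)
Lemma exists_price : (0 < N)%N ->
  exists nu : R, 0 <= nu /\ \sum_(n < N) alloc nu n = 1.
Proof.
move=> N0; pose n0 := Ordinal N0.
have hcont : {within `[0, hitting_price n0],
    continuous (fun nu : R => \sum_(n < N) alloc nu n)}%classic.
  exact/continuous_subspaceT/continuous_sum_allocation.
have [|nu] := IVT (v := 1) (hitting_price_ge0 n0) hcont.
  rewrite ge_min le_max big1 ?ler01 => [|n _]; last exact: allocation_nu0.
  apply/orP; right; rewrite (bigD1 n0)//= allocation_hitting_price lerDl.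
  by apply: sumr_ge0 => n _; exact: allocation_ge0.
by rewrite in_itv/= => /andP[nu0 _] hs; exists nu.
Qed.

End Allocation.

Theorem theorem3 (R : realType) (N : nat) (hN : (1 <= N)%N)
    (gamma beta eps : 'I_N -> R)
    (hgamma : forall n, 0 < gamma n)
    (hbeta : forall n, 0 < beta n)
    (heps : forall n, 0 < eps n)
    (hsum : \sum_(n < N) gamma n = 1) :
  exists alpha : 'I_N -> R,
    [/\ optimal gamma beta eps alpha,
        forall alpha' : 'I_N -> R,
          optimal gamma beta eps alpha' -> forall n, alpha' n = alpha n,
        exists nu : R,
          0 <= nu /\ \sum_(n < N) allocation gamma beta eps nu n = 1
      & forall nu : R,
          0 <= nu -> \sum_(n < N) allocation gamma beta eps nu n = 1 ->
          forall n, alpha n = allocation gamma beta eps nu n].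
Proof.
have [nu [hnu hnu1]] := exists_price hgamma hbeta heps hN.
have hopt := allocation_optimal hgamma hbeta heps hnu hnu1.
exists (allocation gamma beta eps nu); split=> //.
- by move=> x; exact: optimal_eq_allocation.
- by exists nu.
(* The allocation at [nu] is optimal, so uniqueness applied at the price [nu'] identifies the two
   allocations; the prices need not be compared. *)
- by move=> nu' hnu' hnu'1; exact: optimal_eq_allocation.
Qed.
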